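(* Let $S$ be a proper sampling on $[n]$ with weights $\theta_C^i$ satisfying $\mathbb{E}[\theta_S\mathbf{I}_S]e=e$, and let each $f_i:\mathbb{R}^d\to\mathbb{R}$ be $L_i$-smooth and convex. Let $\mathcal{L}_1,\mathcal{L}_2$ be the expected smoothness constants defined in the context. (i) With $\mathcal{L}_{\max}:=\max_{i\in[n]}\sum_{C:\,i\in C}p_CL_C\theta_C^i$, $$\mathcal{L}_j\le\mathcal{L}_{\max}\le\frac1n\max_{i\in[n]}\left\{\sum_{l\in[n]}\ \sum_{C:\,i,l\in C}p_C\theta_C^i\theta_C^lL_l\right\},\qquad j=1,2.$$ Specifically, if $\theta_C^i=\frac{1}{p_i}$ for all $i$ and $C$, then $$\mathcal{L}_j\le\mathcal{L}_{\max}\le\frac1n\max_{i\in[n]}\left\{\sum_{l\in[n]}\frac{\mathbf{P}_{il}}{p_ip_l}L_l\right\},\qquad j=1,2.$$ (ii) $$\mathcal{L}_j\le\frac1n\max_{i\in[n]}\{L_i\beta_i\},\qquad j=1,2.$$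
   Context: $[n]=\{1,\dots,n\}$; $e\in\mathbb{R}^n$ is the all-ones vector. $f=\frac1n\sum_{i=1}^nf_i$; $\psi:\mathbb{R}^d\to\mathbb{R}\cup\{+\infty\}$ is proper closed convex; $x^*$ is a fixed global minimizer of $P=f+\psi$ (assumed to exist). $L$-smooth means differentiable with $L$-Lipschitz gradient. A sampling is a random subset $S$ of $[n]$, with $p_C=\mathbb{P}[S=C]$ and $p_i=\mathbb{P}[i\in S]$; it is proper if $p_i>0$ for all $i$. $\mathbf{P}_{ij}=\mathbb{P}[i\in S\ \&\ j\in S]$. $\theta_S\in\mathbb{R}^{n\times n}$ is a random diagonal matrix (determined by $S$) with diagonal entries $\theta_S^i$, $\mathbf{I}_S$ is the diagonal $0/1$ indicator matrix of $S$, and $\mathbf{G}(x)=[\nabla f_1(x),\dots,\nabla f_n(x)]$, so $\frac1n\mathbf{G}(x)\theta_S\mathbf{I}_Se=\frac1n\sum_{i\in S}\theta_S^i\nabla f_i(x)$. For $C\subseteq[n]$, $L_C$ is the Lipschitz smoothness constant (Lipschitz constant of the gradient) of $f_C:=\frac1n\sum_{i\in C}\theta_C^if_i$. $\beta_i:=\sum_{C\subseteq[n]:\,i\in C}p_C|C|(\theta_C^i)^2$, where $|C|$ is the cardinality of $C$. $\mathcal{L}_1$ is the smallest constant such that for all $x\in\mathbb{R}^d$: $\mathbb{E}\left[\|\frac1n(\mathbf{G}(x)-\mathbf{G}(x^* ))\theta_S\mathbf{I}_Se\|^2\right]\le2\mathcal{L}_1(f(x)-f(x^* )-\langle\nabla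 f(x^* ),x-x^*\rangle)$. $\mathcal{L}_2$ is the smallest constant such that for all $x,y\in\mathbb{R}^d$: $\mathbb{E}\left[\|\frac1n(\mathbf{G}(x)-\mathbf{G}(y))\theta_S\mathbf{I}_Se-\frac1n(\mathbf{G}(x)-\mathbf{G}(y))e\|^2\right]\le2\mathcal{L}_2(f(x)-f(y)-\langle\nabla f(y),x-y\rangle)$.
   Formalization: The first chain of inequalities in (i) is stated only for weights with θ_C^i ≥ 0 whenever i ∈ C and p_C > 0, since it can fail for negative weights; the chain for θ_C^i = 1/p_i and part (ii) carry no such condition. *)

(* Defs.v *)
From HB Require Import structures.
From mathcomp Require Export all_boot all_order all_algebra.
From mathcomp Require Export all_classical all_reals all_analysis.
Export Order.TTheory GRing.Theory Num.Theory.
Export numFieldNormedType.Exports.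

Set Implicit Arguments.
Unset Strict Implicit.
Unset Printing Implicit Defensive.

Local Open Scope classical_set_scope.
Local Open Scope ring_scope.

Section Euclidean.
Context {R : realType} {d : nat}.
Implicit Types x y : 'cV[R]_d.

Definition inner x y : R := \sum_(k < d) x k 0 * y k 0.

(* The library norm `|x| on 'cV[R]_d is the max norm, so the Euclidean norm
   is introduced separately (both induce the same topology). *)
Definition norm2 x : R := Num.sqrt (inner x x).

Definition grad (g : 'cV[R]_d -> R) x : 'cV[R]_d :=
  \col_(k < d) 'D_(delta_mx k 0) g x.

Definition lipschitz2 (L : R) (F : 'cV[R]_d -> 'cV[R]_d) : Prop :=
  forall x y, norm2 (F x - F y) <= L * norm2 (x - y).

Definition smooth (L : R) (g : 'cV[R]_d -> R) : Prop :=
  [/\ 0 <= L, forall x, differentiable g x & lipschitz2 L (grad g)].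

Definition bregman (g : 'cV[R]_d -> R) x y : R :=
  g x - g y - inner (grad g y) (x - y).

(* "Smallest constant" satisfying A: constants are nonnegative, and the value
   is +oo when no real constant satisfies A. *)
Definition smallest (A : R -> Prop) : \bar R :=
  ereal_inf [set L%:E | L in [set L | 0 <= L /\ A L]].

Definition smoothness_constant (g : 'cV[R]_d -> R) : \bar R :=
  smallest (fun L => lipschitz2 L (grad g)).

Definition epigraph (psi : 'cV[R]_d -> \bar R) : set ('cV[R]_d * R^o) :=
  [set z | (psi z.1 <= z.2%:E)%E].

Definition proper_closed_convex (psi : 'cV[R]_d -> \bar R) : Prop :=
  [/\ forall x, psi x != -oo%E,
      exists x, psi x != +oo%E,
      closed (epigraph psi) &
      convex_set (epigraph psi)].

End Euclidean.

(* A random subset of [n], given by its law C |-> P[S = C]. *)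
Record sampling (R : realType) (n : nat) := Sampling {
  sampling_law :> {set 'I_n} -> R ;
  law_ge0 : forall C, 0 <= sampling_law C ;
  law_sum1 : \sum_C sampling_law C = 1 }.

Section Sampling.
Context {R : realType} {n : nat}.
Variable S : sampling R n.

Definition expect (V : lmodType R) (g : {set 'I_n} -> V) : V :=
  \sum_C S C *: g C.

Definition expectR (g : {set 'I_n} -> R) : R := \sum_C S C * g C.

Definition prob (A : pred {set 'I_n}) : R := \sum_(C | A C) S C.

Definition pinc (i : 'I_n) : R := prob (fun C => i \in C).

Definition pmat : 'M[R]_n := \matrix_(i, j) prob (fun C => (i \in C) && (j \in C)).

Definition proper_sampling : Prop := forall i, 0 < pinc i.

(* theta C i is the weight theta_C^i; only the entries with i \in C matter. *)
Variable theta : {set 'I_n} -> 'I_n -> R.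

Definition thetamx (C : {set 'I_n}) : 'M[R]_n := diag_mx (\row_i theta C i).

Definition indmx (C : {set 'I_n}) : 'M[R]_n := diag_mx (\row_i (i \in C)%:R).

Definition ones : 'cV[R]_n := const_mx 1.

Definition unbiased_weights : Prop :=
  expect (fun C => thetamx C *m indmx C) *m ones = ones.

Definition beta_weight (i : 'I_n) : R :=
  \sum_(C : {set 'I_n} | i \in C) S C * #|C|%:R * theta C i ^+ 2.

Section FiniteSum.
Context {d : nat}.
Variable f : 'I_n -> 'cV[R]_d -> R.

Definition favg (x : 'cV[R]_d) : R := n%:R^-1 * \sum_(i < n) f i x.

Definition fsub (C : {set 'I_n}) (x : 'cV[R]_d) : R :=
  n%:R^-1 * \sum_(i in C) theta C i * f i x.

Definition Lsub (C : {set 'I_n}) : \bar R := smoothness_constant (fsub C).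

Definition Gmx (x : 'cV[R]_d) : 'M[R]_(d, n) := \matrix_(k, i) grad (f i) x k 0.

Definition expected_smoothness1 (xstar : 'cV[R]_d) : \bar R :=
  smallest (fun L => forall x,
    expectR (fun C => norm2
      (n%:R^-1 *: ((Gmx x - Gmx xstar) *m thetamx C *m indmx C *m ones)) ^+ 2)
    <= 2 * L * bregman favg x xstar).

Definition expected_smoothness2 : \bar R :=
  smallest (fun L => forall x y,
    expectR (fun C => norm2
      (n%:R^-1 *: ((Gmx x - Gmx y) *m thetamx C *m indmx C *m ones)
       - n%:R^-1 *: ((Gmx x - Gmx y) *m ones)) ^+ 2)
    <= 2 * L * bregman favg x y).

Definition Lmax : \bar R :=
  (\big[maxe/-oo]_(i < n)
     \sum_(C : {set 'I_n} | i \in C) (S C)%:E * Lsub C * (theta C i)%:E)%E.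

End FiniteSum.
End Sampling.

Definition maxn_real {R : realType} {n : nat} (a : 'I_n -> R) : \bar R :=
  (\big[maxe/-oo]_(i < n) (a i)%:E)%E.

Definition global_minimizer {R : realType} {d : nat}
    (P : 'cV[R]_d -> \bar R) (xstar : 'cV[R]_d) : Prop :=
  forall x, (P xstar <= P x)%E.

(* Main.v *)
Require Import Defs.
From mathcomp Require Import ring lra.

Set Implicit Arguments.
Unset Strict Implicit.
Unset Printing Implicit Defensive.

Local Open Scope classical_set_scope.
Local Open Scope ring_scope.

(** Two facts carry the proof.

    The first is cocoercivity: if g is convex and its gradient is L-Lipschitz
    for the Euclidean norm, then
      |grad g x - grad g y|^2 <= 2 L D_g(x, y),
    where D_g is the Bregman divergence of g ([sqr_grad_le_bregman]).  It
    follows from the descent lemma ([descent]), applied to a gradient step of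
    size 1/L, and from the nonnegativity of D_g ([convex_bregman_ge0]).

    The second is linearity: f_C and f are linear combinations of the f_i, so
    their gradients and their Bregman divergences are the corresponding
    combinations of those of the f_i.

    Both constants are controlled by the same second moment bound
      E |X_S|^2 <= 2 M D_f(x, y),  X_C = grad f_C x - grad f_C y,
    because unbiasedness says that E X_S = grad f x - grad f y, and a variance
    is at most the second moment ([expected_smoothness_le]).

    For the bound by L_max, cocoercivity of each f_C gives
      E |X_S|^2 <= 2 sum_C p_C L_C D_{f_C}(x, y)
                 = (2/n) sum_i D_{f_i}(x, y) sum_{C : i in C} p_C L_C theta_C^i
    ([second_moment_le_Lmax]); nonnegative weights on the support of the
    sampling make f_C convex.  The upper bound on L_max comes from
    L_C <= (1/n) sum_{l in C} theta_C^l L_l.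

    For the bound by the beta_i, Cauchy--Schwarz on the |C| summands of X_C
    followed by cocoercivity of each f_i gives
      E |X_S|^2 <= (2/n^2) sum_i L_i beta_i D_{f_i}(x, y)
    ([second_moment_le_beta]). *)

(** * The Euclidean inner product *)

Section Inner.
Context {R : realType} {d : nat}.
Implicit Types (x y z u v : 'cV[R]_d) (a : R).

Lemma innerC x y : inner x y = inner y x.
Proof. by apply: eq_bigr => k _; rewrite mulrC. Qed.

Lemma innerDl x y z : inner (x + y) z = inner x z + inner y z.
Proof. by rewrite -big_split; apply: eq_bigr => k _; rewrite mxE mulrDl. Qed.

Lemma innerZl a x y : inner (a *: x) y = a * inner x y.
Proof. by rewrite /inner mulr_sumr; apply: eq_bigr => k _; rewrite mxE mulrA. Qed.

Lemma innerDr x y z : inner x (y + z) = inner x y + inner x z.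
Proof. by rewrite innerC innerDl !(innerC x). Qed.

Lemma innerZr a x y : inner x (a *: y) = a * inner x y.
Proof. by rewrite innerC innerZl innerC. Qed.

Lemma innerBl x y z : inner (x - y) z = inner x z - inner y z.
Proof. by rewrite -scaleN1r innerDl innerZl mulN1r. Qed.

Lemma innerBr x y z : inner x (y - z) = inner x y - inner x z.
Proof. by rewrite innerC innerBl !(innerC x). Qed.

Lemma inner_suml (I : Type) (r : seq I) (P : pred I) (F : I -> 'cV[R]_d) y :
  inner (\sum_(i <- r | P i) F i) y = \sum_(i <- r | P i) inner (F i) y.
Proof.
elim/big_rec2 : _ => [|i b c _ <-]; last by rewrite innerDl.
by apply: big1 => k _; rewrite mxE mul0r.
Qed.

Lemma inner_ge0 x : 0 <= inner x x.
Proof. by apply: sumr_ge0 => k _; rewrite -expr2 sqr_ge0. Qed.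

Lemma inner_eq0 x : inner x x = 0 -> x = 0.
Proof.
move=> /eqP; rewrite psumr_eq0 => [/allP x0|k _]; last by rewrite -expr2 sqr_ge0.
apply/colP => k; rewrite mxE; apply/eqP.
by have := x0 k (mem_index_enum k); rewrite /= mulf_eq0 orbb.
Qed.

Lemma norm2_ge0 x : 0 <= norm2 x.
Proof. exact: sqrtr_ge0. Qed.

Lemma norm2_sqr x : norm2 x ^+ 2 = inner x x.
Proof. by rewrite sqr_sqrtr// inner_ge0. Qed.

Lemma norm2_0 : norm2 (0 : 'cV[R]_d) = 0.
Proof. by rewrite /norm2 -(scale0r 0) innerZl mul0r sqrtr0. Qed.

Lemma norm2Z a x : norm2 (a *: x) = `|a| * norm2 x.
Proof. by rewrite /norm2 innerZl innerZr mulrA sqrtrM -?expr2 ?sqr_ge0// sqrtr_sqr. Qed.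

(** The Cauchy--Schwarz inequality, by expanding the squared norm of
    |y|^2 x - <x, y> y. *)
Lemma inner_le_norm2 x y : inner x y <= norm2 x * norm2 y.
Proof.
have [y0|y0] := eqVneq (inner y y) 0.
  rewrite (inner_eq0 y0) norm2_0 mulr0 innerC -(scale0r 0) innerZl mul0r.
  by [].
have ygt0 : 0 < inner y y by rewrite lt0r y0 inner_ge0.
rewrite /norm2 -sqrtrM ?inner_ge0// (le_trans (ler_norm _))// -sqrtr_sqr.
apply: ler_wsqrtr.
have := inner_ge0 (inner y y *: x - inner x y *: y).
rewrite innerBl !innerBr !innerZl !innerZr (innerC y x).
set a := inner x x; set b := inner y y in ygt0 *; set c := inner x y => h.
rewrite -subr_ge0 -(pmulr_rge0 _ ygt0); apply: (le_trans h); lra.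
Qed.

Lemma norm2D x y : norm2 (x + y) <= norm2 x + norm2 y.
Proof.
rewrite -(@ler_pXn2r _ 2)// ?nnegrE ?addr_ge0 ?norm2_ge0//.
rewrite sqrrD !norm2_sqr innerDl !innerDr (innerC y x).
have := inner_le_norm2 x y; lra.
Qed.

Lemma norm2_sum (I : Type) (r : seq I) (P : pred I) (F : I -> 'cV[R]_d) :
  norm2 (\sum_(i <- r | P i) F i) <= \sum_(i <- r | P i) norm2 (F i).
Proof.
elim/big_rec2 : _ => [|i b c _ h]; first by rewrite norm2_0.
by rewrite (le_trans (norm2D _ _))// lerD2l.
Qed.

End Inner.

(** * Directional derivatives, convexity and the descent lemma *)

Section Gradient.
Context {R : realType} {d : nat}.
Implicit Types (g : 'cV[R]_d -> R) (x y u : 'cV[R]_d).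

Lemma derive_inner g x u : differentiable g x -> 'D_u g x = inner (grad g x) u.
Proof.
move=> dg; rewrite deriveE// {1}(matrix_sum_delta u) linear_sum.
apply: eq_bigr => k _; rewrite big_ord1 linearZ/= mxE deriveE//.
by rewrite mulrC.
Qed.

Lemma is_derive_line g x u (t : R) : differentiable g (x + t *: u) ->
  is_derive t 1 (fun s : R => g (x + s *: u)) (inner (grad g (x + t *: u)) u).
Proof.
move=> dg; have dgu : derivable g (x + t *: u) u by exact: diff_derivable.
(* Both difference quotients are the same function of the increment h. *)
have E : (fun h : R =>
    h^-1 *: (((fun s : R => g (x + s *: u)) \o shift t) (h *: 1) - g (x + t *: u)))
  = (fun h : R => h^-1 *: ((g \o shift (x + t *: u)) (h *: u) - g (x + t *: u))).
  apply/funext => h /=; congr (_ *: (g _ - _)).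
  by rewrite scalerDl addrC -addrA [h *: 1]mulr1 [t *: u + _]addrC addrCA.
apply: DeriveDef; first by rewrite /derivable E.
by rewrite -derive_inner// /derive E.
Qed.

(** The first order characterization of convexity: the graph lies above its
    tangent hyperplanes. *)
Lemma convex_bregman_ge0 g x y : convex_function setT g ->
  differentiable g y -> 0 <= bregman g x y.
Proof.
move=> cg dg; rewrite /bregman -derive_inner// subr_ge0.
have /cvg_dnbhs_at_right cv : derivable g y (x - y) by exact: diff_derivable.
apply: (cvgr_to_le cv); near=> h.
have h0 : 0 < h by near: h; exact: nbhs_right_gt.
have h1 : h <= 1 by near: h; exact: nbhs_right_le.
have hi : Itv.spec (Itv.num_sem (R:=R)) (Itv.Real `[0%Z, 1%Z]) h.
  by rewrite /= /Itv.num_sem/= in_itv/= (ltW h0) h1 realE ltW.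
have H : g (h *: x + (1 - h) *: y) <= h * g x + (1 - h) * g y.
  exact: cg (Itv.mk hi) x y (mem_setT _) (mem_setT _).
rewrite /= [_ *: _]mulrC ler_pdivrMr//.
have -> : h *: (x - y) + y = h *: x + (1 - h) *: y.
  by rewrite scalerBr scalerBl scale1r -addrA [- _ + _]addrC.
rewrite lerBlDr (le_trans H)//; lra.
Unshelve. all: by end_near. Qed.

(** The descent lemma: the derivative of
    t |-> g (x + t u) - t <grad g x, u> - L t^2 |u|^2 / 2
    is nonpositive for positive t, by Cauchy--Schwarz. *)
Lemma descent g (L : R) x u : (forall z, differentiable g z) ->
  lipschitz2 L (grad g) ->
  g (x + u) <= g x + inner (grad g x) u + L / 2 * inner u u.
Proof.
move=> dg lg.
pose phi : R -> R := (fun s : R => g (x + s *: u)) -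
  (fun s : R => inner (grad g x) u * s + L / 2 * inner u u * s ^+ 2).
pose dphi (s : R) := inner (grad g (x + s *: u)) u -
  (inner (grad g x) u + L * inner u u * s).
have dphiP (s : R) : is_derive s 1 phi (dphi s).
  apply: is_deriveB; first exact: is_derive_line.
  have -> : (fun s : R => inner (grad g x) u * s + L / 2 * inner u u * s ^+ 2) =
    (inner (grad g x) u \*: id) + ((L / 2 * inner u u) \*: (id ^+ 2)).
    by apply/funext => r.
  apply: is_derive_eq; rewrite /GRing.scale/=; lra.
(* The derivative hypothesis is found by instance resolution from dphiP. *)
have [|c] := @MVT_segment _ phi dphi 0 1 ler01.
  apply: derivable_within_continuous => ? _.
  exact: (@ex_derive _ _ _ _ _ _ _ (dphiP _)).
rewrite in_itv/= => /andP[c0 _] E.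
have : dphi c <= 0.
  have [->|cn0] := eqVneq c 0.
    by rewrite /dphi scale0r addr0 mulr0 addr0 subrr.
  have cgt0 : 0 < c by rewrite lt0r cn0.
  rewrite /dphi opprD addrA -innerBl subr_le0 -(ler_pM2l cgt0) -(innerZr c).
  apply: (le_trans (inner_le_norm2 _ _)).
  have := lg (x + c *: u) x.
  have -> : x + c *: u - x = c *: u by rewrite addrAC subrr add0r.
  move=> lgc.
  apply: (le_trans (ler_wpM2r (norm2_ge0 _) lgc)).
  rewrite -[leLHS]mulrA -[norm2 _ * _]expr2 norm2_sqr innerZl innerZr; lra.
move: E; rewrite /phi !fctE /= scale0r addr0 scale1r.
lra.
Qed.

End Gradient.

(** * Cocoercivity of the gradient *)

Section Cocoercivity.
Context {R : realType} {d : nat}.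
Implicit Types (g : 'cV[R]_d -> R) (x y : 'cV[R]_d).

(** Cocoercivity of the gradient.  The point x - (1/L) (grad g x - grad g y)
    is a gradient step from x for h := g - <grad g y, .>; the step lowers h by
    at least |grad h x|^2 / (2 L), and y is a global minimizer of h. *)
Lemma sqr_grad_le_bregman g (L : R) x y : 0 <= L ->
  (forall z, differentiable g z) -> (forall z, 0 <= bregman g z y) ->
  lipschitz2 L (grad g) ->
  norm2 (grad g x - grad g y) ^+ 2 <= 2 * L * bregman g x y.
Proof.
move=> L0 dg bg lg; have [L_eq0|Lneq0] := eqVneq L 0.
  have := lg x y; rewrite L_eq0 mul0r mulr0 mul0r => le0.
  by rewrite expr2 mulr_ge0_le0// norm2_ge0.
have Lgt0 : 0 < L by rewrite lt0r Lneq0.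
rewrite norm2_sqr; set v := grad g x - grad g y.
have step := descent x (- L^-1 *: v) dg lg.
have := bg (x + - L^-1 *: v); rewrite /bregman.
have -> : x + - L^-1 *: v - y = (x - y) + - L^-1 *: v by rewrite addrAC.
rewrite innerDr; move: step; rewrite !innerZr innerZl.
have -> : inner (grad g x) v = inner v v + inner (grad g y) v.
  by rewrite -innerDl subrK.
set w := inner v v; set q := inner (grad g y) v => step ge0.
have {step ge0} : L^-1 / 2 * w <= g x - g y - inner (grad g y) (x - y).
  suff : L / 2 * (- L^-1 * (- L^-1 * w)) = L^-1 / 2 * w by lra.
  by field.
rewrite -(ler_pM2l (_ : 0 < 2 * L)) ?mulr_gt0//; apply: le_trans.
suff -> : 2 * L * (L^-1 / 2 * w) = w by [].
by field.
Qed.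

End Cocoercivity.

(** * Linear combinations of functions *)

(** The linear combination of the functions f i with coefficients a i. *)
Definition lincomb {R : realType} {n d : nat} (f : 'I_n -> 'cV[R]_d -> R)
  (a : 'I_n -> R) (x : 'cV[R]_d) : R := \sum_(i < n) a i * f i x.

Section LinearCombination.
Context {R : realType} {n d : nat} (f : 'I_n -> 'cV[R]_d -> R).
Hypothesis df : forall i x, differentiable (f i) x.
Implicit Types (a : 'I_n -> R) (x y : 'cV[R]_d).

Lemma lincombE a : lincomb f a = \sum_(i < n) a i \*: f i.
Proof. by apply/funext => x; rewrite fct_sumE. Qed.

Lemma differentiable_lincomb a x : differentiable (lincomb f a) x.
Proof.
rewrite lincombE; apply: differentiable_sum => i; exact: differentiableZ.
Qed.

Lemma grad_lincomb a x : grad (lincomb f a) x = \sum_(i < n) a i *: grad (f i) x.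
Proof.
apply/colP => k; rewrite lincombE !mxE summxE derive_sum; last first.
  by move=> i; apply/derivableZ/diff_derivable.
apply: eq_bigr => i _; rewrite deriveZ ?mxE//; exact: diff_derivable.
Qed.

Lemma grad_lincombB a x y : grad (lincomb f a) x - grad (lincomb f a) y =
  \sum_(i < n) a i *: (grad (f i) x - grad (f i) y).
Proof.
by rewrite !grad_lincomb -sumrB; apply: eq_bigr => i _; rewrite scalerBr.
Qed.

Lemma bregman_lincomb a x y :
  bregman (lincomb f a) x y = \sum_(i < n) a i * bregman (f i) x y.
Proof.
rewrite /bregman grad_lincomb inner_suml /lincomb -!sumrB.
by apply: eq_bigr => i _; rewrite innerZl !mulrBr.
Qed.

Lemma lipschitz2_lincomb a (L : 'I_n -> R) :
  (forall i, lipschitz2 (L i) (grad (f i))) ->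
  lipschitz2 (\sum_(i < n) `|a i| * L i) (grad (lincomb f a)).
Proof.
move=> lf x y; rewrite grad_lincombB; apply: (le_trans (norm2_sum _ _ _)).
rewrite mulr_suml; apply: ler_sum => i _; rewrite norm2Z -mulrA ler_wpM2l ?normr_ge0//.
exact: lf.
Qed.

End LinearCombination.

(** * Smallest constants and finite maxima *)

Section SmallestConstant.
Context {R : realType}.

Lemma smallest_le (A : R -> Prop) (M : R) : 0 <= M -> A M ->
  (smallest A <= M%:E)%E.
Proof. by move=> M0 AM; apply: ereal_inf_lbound; exists M. Qed.

(** The best Lipschitz constant of a Lipschitz map is real and attained. *)
Lemma smallest_lipschitz2 d (F : 'cV[R]_d -> 'cV[R]_d) (L0 : R) :
  0 <= L0 -> lipschitz2 L0 F ->
  exists K : R, [/\ smallest (fun L => lipschitz2 L F) = K%:E, 0 <= K,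
    lipschitz2 K F & forall L, 0 <= L -> lipschitz2 L F -> K <= L].
Proof.
move=> L0ge0 lF; set s := smallest _.
have s_le L : 0 <= L -> lipschitz2 L F -> (s <= L%:E)%E by exact: smallest_le.
have s_ge0 : (0 <= s)%E.
  by apply: le_ereal_inf_tmp => _ [L [? _] <-]; rewrite lee_fin.
have s_fin : s \is a fin_num.
  by rewrite ge0_fin_numE// (le_lt_trans (s_le _ L0ge0 lF))// ltry.
exists (fine s); split; rewrite ?fineK//.
- exact: fine_ge0.
- move=> x y; have [xy0|xy0] := eqVneq (norm2 (x - y)) 0.
    by have := lF x y; rewrite xy0 !mulr0.
  have xy_gt0 : 0 < norm2 (x - y) by rewrite lt0r xy0 norm2_ge0.
  rewrite -ler_pdivrMr// -lee_fin fineK//.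
  apply: le_ereal_inf_tmp => _ [L [_ lL] <-].
  by rewrite lee_fin ler_pdivrMr.
- by move=> L ? lL; rewrite -lee_fin fineK// s_le.
Qed.

Lemma maxn_real_attained n (a : 'I_n -> R) : (0 < n)%N ->
  exists i0, maxn_real a = (a i0)%:E /\ forall i, a i <= a i0.
Proof.
move=> n0; have [i0 _ E] := @eq_bigmax _ _ _ -oo%E (Ordinal n0) predT
  (fun i => (a i)%:E) isT (fun i _ => leNye _).
exists i0; split => // i; rewrite -lee_fin -E; exact: le_bigmax.
Qed.

End SmallestConstant.

(** * Second moment bounds for a sampling *)

Section Sampling.
Context {R : realType} {n d : nat}.
Variables (S : sampling R n) (theta : {set 'I_n} -> 'I_n -> R).
Variables (f : 'I_n -> 'cV[R]_d -> R) (L : 'I_n -> R).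
Implicit Types (C : {set 'I_n}) (x y : 'cV[R]_d).

(** The coefficient of f i in f_C, zero when i is not in C. *)
Definition coeff C (i : 'I_n) : R := n%:R^-1 * (theta C i *+ (i \in C)).

(** The increment between y and x of the gradient estimator on the event
    S = C. *)
Definition estimator C x y : 'cV[R]_d :=
  \sum_(i < n) coeff C i *: (grad (f i) x - grad (f i) y).

Lemma fsubE C : fsub theta f C = lincomb f (coeff C).
Proof.
apply/funext => x; rewrite /fsub /lincomb mulr_sumr big_mkcond/=.
apply: eq_bigr => i _; rewrite /coeff; case: ifP => _; first by rewrite mulrA.
by rewrite mulr0n mulr0 mul0r.
Qed.

Lemma favgE : favg f = lincomb f (fun=> n%:R^-1).
Proof. by apply/funext => x; rewrite /favg /lincomb mulr_sumr. Qed.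

Lemma theta_ind_ones C :
  thetamx theta C *m (indmx C *m ones) = \col_i (theta C i *+ (i \in C)).
Proof.
apply/colP => i; rewrite /thetamx /indmx !mul_diag_mx !mxE mulr1.
by rewrite mulr_natr.
Qed.

Lemma estimatorE C x y :
  n%:R^-1 *: ((Gmx f x - Gmx f y) *m thetamx theta C *m indmx C *m ones) =
  estimator C x y.
Proof.
rewrite -!mulmxA theta_ind_ones; apply/colP => k; rewrite summxE !mxE mulr_sumr.
by apply: eq_bigr => i _; rewrite !mxE /coeff; ring.
Qed.

Lemma full_gradientE x y : n%:R^-1 *: ((Gmx f x - Gmx f y) *m ones) =
  \sum_(i < n) n%:R^-1 *: (grad (f i) x - grad (f i) y).
Proof.
rewrite -scaler_sumr; congr (_ *: _); apply/colP => k; rewrite summxE mxE.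
by apply: eq_bigr => i _; rewrite !mxE mulr1.
Qed.

Lemma expect_coeff i : unbiased_weights S theta ->
  \sum_C S C * coeff C i = n%:R^-1.
Proof.
move=> /colP/(_ i); rewrite /expect mulmx_suml summxE [RHS]mxE => E.
rewrite -[RHS]mulr1 -[X in _ = _ * X]E mulr_sumr; apply: eq_bigr => C _.
by rewrite -scalemxAl -mulmxA theta_ind_ones !mxE /coeff mulrCA.
Qed.

(** The variance of a random vector is at most its second moment. *)
Lemma variance_le (X : {set 'I_n} -> 'cV[R]_d) (m : 'cV[R]_d) :
  \sum_C S C *: X C = m ->
  \sum_C S C * norm2 (X C - m) ^+ 2 <= \sum_C S C * norm2 (X C) ^+ 2.
Proof.
move=> Em.
have -> : \sum_C S C * norm2 (X C - m) ^+ 2 =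
    \sum_C S C * norm2 (X C) ^+ 2 - inner m m.
  transitivity (\sum_C S C * norm2 (X C) ^+ 2
    - 2 * inner (\sum_C S C *: X C) m + (\sum_C S C) * inner m m).
    rewrite inner_suml mulr_sumr mulr_suml -sumrB -big_split/=.
    apply: eq_bigr => C _.
    rewrite !norm2_sqr innerZl innerBl !innerBr (innerC m (X C)); ring.
  rewrite Em law_sum1; ring.
by rewrite gerBl inner_ge0.
Qed.

(** Unbiasedness makes the second constant a bound on a variance, so that a
    single second moment bound controls both constants. *)
Lemma expected_smoothness_le xstar (M : R) : unbiased_weights S theta ->
  0 <= M ->
  (forall x y, \sum_C S C * norm2 (estimator C x y) ^+ 2
     <= 2 * M * bregman (favg f) x y) ->
  (expected_smoothness1 S theta f xstar <= M%:E)%E /\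
  (expected_smoothness2 S theta f <= M%:E)%E.
Proof.
move=> ub M0 H; split; apply: smallest_le => // x.
  by rewrite /expectR; under eq_bigr do rewrite estimatorE; exact: H.
move=> y; apply: le_trans (H x y); rewrite /expectR full_gradientE.
set m := (X in _ - X).
under eq_bigr do rewrite estimatorE.
apply: variance_le; rewrite /m.
under eq_bigr do rewrite scaler_sumr.
rewrite exchange_big/=; apply: eq_bigr => i _; rewrite -(expect_coeff i ub).
by rewrite scaler_suml; apply: eq_bigr => C _; rewrite scalerA.
Qed.

Hypothesis df : forall i x, differentiable (f i) x.
Hypothesis bf : forall i x y, 0 <= bregman (f i) x y.
Hypothesis L_ge0 : forall i, 0 <= L i.
Hypothesis lf : forall i, lipschitz2 (L i) (grad (f i)).

Lemma bregman_favg x y :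
  bregman (favg f) x y = n%:R^-1 * \sum_(i < n) bregman (f i) x y.
Proof. by rewrite favgE bregman_lincomb// mulr_sumr. Qed.

(** f_C has a real best smoothness constant, at most
    (1/n) sum_(i in C) |theta_C^i| L_i whatever the signs of the weights. *)
Lemma Lsub_attained C : exists K : R, [/\ Lsub theta f C = K%:E, 0 <= K,
  lipschitz2 K (grad (fsub theta f C)) &
  K <= \sum_(i < n) `|coeff C i| * L i].
Proof.
have ge0 : 0 <= \sum_(i < n) `|coeff C i| * L i.
  by apply: sumr_ge0 => i _; rewrite mulr_ge0.
have lC : lipschitz2 (\sum_(i < n) `|coeff C i| * L i) (grad (fsub theta f C)).
  by rewrite fsubE; exact: lipschitz2_lincomb.
have [K [E K0 lK Kmin]] := smallest_lipschitz2 ge0 lC.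
by exists K; split => //; exact: Kmin.
Qed.

(** Cocoercivity of each f_C, with K C any Lipschitz constant of its gradient,
    averaged over the sampling. *)
Lemma second_moment_le_Lmax (K : {set 'I_n} -> R) (M : R) :
  (forall C, 0 <= K C) ->
  (forall C, lipschitz2 (K C) (grad (fsub theta f C))) ->
  (forall C i, 0 < S C -> i \in C -> 0 <= theta C i) ->
  (forall i, \sum_(C : {set 'I_n} | i \in C) S C * K C * theta C i <= M) ->
  forall x y, \sum_C S C * norm2 (estimator C x y) ^+ 2
    <= 2 * M * bregman (favg f) x y.
Proof.
move=> K0 lK th0 KM x y.
have cw C i : 0 < S C -> 0 <= coeff C i.
  move=> SC; rewrite /coeff mulr_ge0// ?invr_ge0//.
  by case: (boolP (i \in C)) => // iC; rewrite mulr1n th0.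
apply: (@le_trans _ _
  (\sum_C S C * (2 * K C * \sum_(i < n) coeff C i * bregman (f i) x y))).
  apply: ler_sum => C _.
  (* f_C need not be convex when S C = 0, but it then does not contribute. *)
  have [<-|SC0] := eqVneq 0 (S C); first by rewrite !mul0r.
  have SC : 0 < S C by rewrite lt0r eq_sym SC0 law_ge0.
  rewrite ler_wpM2l ?law_ge0// /estimator -grad_lincombB// -bregman_lincomb//.
  have lC := lK C; rewrite fsubE in lC; apply: sqr_grad_le_bregman => // z.
    exact: differentiable_lincomb.
  rewrite bregman_lincomb//; apply: sumr_ge0 => i _.
  by rewrite mulr_ge0// cw.
rewrite bregman_favg !mulr_sumr.
under eq_bigr do rewrite !mulr_sumr.
rewrite exchange_big/=; apply: ler_sum => i _.
(* The coefficient of the divergence of f i is factored out. *)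
apply: (@le_trans _ _ (2 * n%:R^-1 * bregman (f i) x y *
   \sum_(C : {set 'I_n} | i \in C) S C * K C * theta C i)).
  rewrite le_eqVlt; apply/orP; left; apply/eqP.
  rewrite [in RHS]big_mkcond mulr_sumr; apply: eq_bigr => C _.
  by rewrite /coeff; case: ifP => _; rewrite ?mulr1n ?mulr0n; ring.
rewrite (le_trans (ler_wpM2l _ (KM i)))// ?mulr_ge0// ?invr_ge0//; lra.
Qed.

(** Cauchy--Schwarz in R^n for the indicator vector of C and the vector of the
    norms of the v i. *)
Lemma sqr_norm2_sum_le (C : {set 'I_n}) (v : 'I_n -> 'cV[R]_d) :
  norm2 (\sum_(i in C) v i) ^+ 2 <= #|C|%:R * \sum_(i in C) norm2 (v i) ^+ 2.
Proof.
pose u : 'cV[R]_n := \col_i (i \in C)%:R.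
pose w : 'cV[R]_n := \col_i (norm2 (v i) *+ (i \in C)).
have uu : inner u u = #|C|%:R.
  rewrite -sum1_card natr_sum [RHS]big_mkcond; apply: eq_bigr => i _.
  by rewrite !mxE; case: (i \in C); rewrite ?mulr1 ?mulr0.
have ww : inner w w = \sum_(i in C) norm2 (v i) ^+ 2.
  rewrite [RHS]big_mkcond; apply: eq_bigr => i _.
  by rewrite !mxE; case: (i \in C); rewrite ?mulr0// mulr1n expr2.
have uw : inner u w = \sum_(i in C) norm2 (v i).
  rewrite [RHS]big_mkcond; apply: eq_bigr => i _.
  by rewrite !mxE; case: (i \in C); rewrite ?mul0r// mul1r mulr1n.
rewrite -uu -ww -!norm2_sqr -exprMn ler_pXn2r ?nnegrE ?mulr_ge0 ?norm2_ge0//.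
by rewrite (le_trans (norm2_sum _ _ _))// -uw inner_le_norm2.
Qed.

(** Cocoercivity of each f i, after Cauchy--Schwarz on the |C| terms of the
    estimator; no sign condition on the weights is needed. *)
Lemma second_moment_le_beta (M : R) :
  (forall i, n%:R^-1 * (L i * beta_weight S theta i) <= M) ->
  forall x y, \sum_C S C * norm2 (estimator C x y) ^+ 2
    <= 2 * M * bregman (favg f) x y.
Proof.
move=> LM x y.
apply: (@le_trans _ _ (\sum_C S C * (#|C|%:R *
   \sum_(i in C) (n%:R^-1 * theta C i) ^+ 2 * (2 * L i * bregman (f i) x y)))).
  apply: ler_sum => C _; rewrite ler_wpM2l ?law_ge0//.
  have -> : estimator C x y =
      \sum_(i in C) (n%:R^-1 * theta C i) *: (grad (f i) x - grad (f i) y).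
    rewrite [RHS]big_mkcond; apply: eq_bigr => i _; rewrite /coeff.
    by case: ifP; rewrite ?mulr1n// mulr0n mulr0 scale0r.
  rewrite (le_trans (sqr_norm2_sum_le _ _))// ler_wpM2l//.
  apply: ler_sum => i _; rewrite norm2Z exprMn real_normK ?num_real//.
  by rewrite ler_wpM2l ?sqr_ge0//; apply: sqr_grad_le_bregman.
rewrite bregman_favg !mulr_sumr.
under eq_bigr do rewrite !mulr_sumr big_mkcond/=.
rewrite exchange_big/=; apply: ler_sum => i _.
apply: (@le_trans _ _ (2 * n%:R^-1 * bregman (f i) x y *
   (n%:R^-1 * (L i * beta_weight S theta i)))).
  rewrite le_eqVlt; apply/orP; left; apply/eqP.
  rewrite /beta_weight [in RHS]big_mkcond !mulr_sumr; apply: eq_bigr => C _.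
  by case: ifP => _; ring.
rewrite (le_trans (ler_wpM2l _ (LM i)))// ?mulr_ge0// ?invr_ge0//; lra.
Qed.

End Sampling.

(** * The bounds on the expected smoothness constants *)

Theorem lemmaF1 (R : realType) (n d : nat) (n_gt0 : (0 < n)%N)
  (f : 'I_n -> 'cV[R]_d -> R) (L : 'I_n -> R)
  (psi : 'cV[R]_d -> \bar R) (xstar : 'cV[R]_d)
  (S : sampling R n) (theta : {set 'I_n} -> 'I_n -> R)
  (f_smooth : forall i, smooth (L i) (f i))
  (f_convex : forall i, convex_function setT (f i))
  (psi_pcc : proper_closed_convex psi)
  (xstar_min : global_minimizer (fun x => (favg f x)%:E + psi x)%E xstar)
  (S_proper : proper_sampling S)
  (theta_unbiased : unbiased_weights S theta) :
  let L1 := expected_smoothness1 S theta f xstar in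
  let L2 := expected_smoothness2 S theta f in
  let LM := Lmax S theta f in
  [/\ (forall C i, 0 < S C -> i \in C -> 0 <= theta C i) ->
      [/\ (L1 <= LM)%E, (L2 <= LM)%E &
          (LM <= (n%:R^-1)%:E * maxn_real (fun i =>
             (\sum_(l < n) \sum_(C : {set 'I_n} | (i \in C) && (l \in C))
                S C * theta C i * theta C l * L l)%R))%E],
      (forall C i, theta C i = (pinc S i)^-1) ->
      [/\ (L1 <= LM)%E, (L2 <= LM)%E &
          (LM <= (n%:R^-1)%:E * maxn_real (fun i =>
             (\sum_(l < n) pmat S i l / (pinc S i * pinc S l) * L l)%R))%E] &
      (L1 <= (n%:R^-1)%:E * maxn_real (fun i => (L i * beta_weight S theta i)%R))%E /\
      (L2 <= (n%:R^-1)%:E * maxn_real (fun i => (L i * beta_weight S theta i)%R))%E].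

Proof.
have df i x : differentiable (f i) x by have [_ + _] := f_smooth i.
have L_ge0 i : 0 <= L i by have [] := f_smooth i.
have lf i : lipschitz2 (L i) (grad (f i)) by have [] := f_smooth i.
have bf i x y : 0 <= bregman (f i) x y by exact: convex_bregman_ge0.
move=> L1 L2 LM.
(* The case of weights 1 / p_i is an instance of that of nonnegative weights. *)
have nonneg_case : (forall C i, 0 < S C -> i \in C -> 0 <= theta C i) ->
    [/\ (L1 <= LM)%E, (L2 <= LM)%E &
        (LM <= (n%:R^-1)%:E * maxn_real (fun i =>
           (\sum_(l < n) \sum_(C : {set 'I_n} | (i \in C) && (l \in C))
              S C * theta C i * theta C l * L l)%R))%E].
  move=> th0.
  have [K KP] := choice (Lsub_attained theta df L_ge0 lf).
  pose a i := \sum_(C : {set 'I_n} | i \in C) S C * K C * theta C i.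
  have LMa : LM = maxn_real a.
    apply: eq_bigr => i _; rewrite -sumEFin; apply: eq_bigr => C _.
    by have [-> _ _ _] := KP C.
  have [i0 [Ea a_le]] := maxn_real_attained a n_gt0.
  have a_ge0 : 0 <= a i0.
    apply: sumr_ge0 => C iC; have [_ K0 _ _] := KP C.
    have [<-|SC0] := eqVneq 0 (S C); first by rewrite !mul0r.
    by rewrite !mulr_ge0 ?law_ge0// th0// lt0r eq_sym SC0 law_ge0.
  rewrite LMa Ea; have [] := @expected_smoothness_le _ _ _ S theta f xstar (a i0)
    theta_unbiased a_ge0.
    apply: (@second_moment_le_Lmax _ _ _ S theta f df bf K) => // C.
      by have [] := KP C.
    by have [] := KP C.
  move=> L1a L2a; split => //.
  set b := fun i => _; have [i1 [-> b_le]] := maxn_real_attained b n_gt0.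
  rewrite -EFinM lee_fin; apply: (@le_trans _ _ (n%:R^-1 * b i0)); last first.
    by rewrite ler_wpM2l// invr_ge0.
  (* For the index i0 attaining L_max, insert the bound on each L_C. *)
  rewrite /a /b (exchange_big_dep (fun C : {set 'I_n} => i0 \in C))/= => [|l C _ /andP[]//].
  rewrite mulr_sumr; apply: ler_sum => C iC; have [_ K0 _ Kle] := KP C.
  have [<-|SC0] := eqVneq 0 (S C).
    by rewrite !mul0r big1 ?mulr0// => l _; rewrite !mul0r.
  have SC : 0 < S C by rewrite lt0r eq_sym SC0 law_ge0.
  rewrite -mulrA [K C * _]mulrC mulrA.
  apply: (le_trans (ler_wpM2l _ Kle)); first by rewrite mulr_ge0 ?law_ge0// th0.
  rewrite le_eqVlt; apply/orP; left; apply/eqP.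
  rewrite !mulr_sumr [RHS]big_mkcond/=; apply: eq_bigr => l _; rewrite iC /coeff.
  case: (boolP (l \in C)) => lC; last by rewrite mulr0n mulr0 normr0 mul0r mulr0.
  by rewrite mulr1n ger0_norm ?mulr_ge0 ?invr_ge0 ?th0//; ring.
split.
- exact: nonneg_case.
- move=> thE; have [|L1le L2le LMle] := nonneg_case.
    by move=> C i _ _; rewrite thE invr_ge0 ltW.
  split => //; apply: (le_trans LMle); rewrite le_eqVlt; apply/orP; left; apply/eqP.
  congr (_ * maxn_real _)%E; apply/funext => i; apply: eq_bigr => l _.
  rewrite mxE /prob 2!mulr_suml; apply: eq_bigr => C _.
  by rewrite !thE invfM; ring.
- have [i0 [-> le]] := maxn_real_attained (fun i => L i * beta_weight S theta i) n_gt0.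
  rewrite -EFinM; apply: expected_smoothness_le => //.
    rewrite !mulr_ge0 ?invr_ge0//; apply: sumr_ge0 => C _.
    by rewrite mulr_ge0 ?sqr_ge0// mulr_ge0 ?law_ge0.
  apply: second_moment_le_beta => // i.
  by rewrite ler_wpM2l// invr_ge0.
Qed.
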